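(* Assume that $Y$ is a real topological-linear space, $\psi:Y\to\mathbb R$ is a seminorm, and $K,A\subseteq Y$ are nontrivial cones with normlike-bases $B_K(\psi)$ and $B_A(\psi)$. Suppose that $$A\cap\operatorname{cl}(\operatorname{conv}(-K))=\{0\}\quad\text{and}\quad 0\notin\operatorname{cl}S_{-K}(\psi),$$ and that one of the following statements is satisfied: (a) $A$ is closed and convex. (b) There is $(x^*,\alpha)\in Y^*\times\mathbb P$ such that $\operatorname{cl}S_{-K}(\psi)=\{x\in\operatorname{cl}\mathbb B_\psi\mid x^*(x)\ge\alpha\}$, and one of the following conditions is satisfied: (i) $B_A(\psi)$ is compact; (ii) $S^0_A(\psi)$ is closed; (iii) $A$ is closed and $\operatorname{cl}B_A(\psi)$ is compact; (iv) $A$ is closed and $\operatorname{conv}(\operatorname{cl}(B_A(\psi))\cup\{0\})$ is closed. Then $(\operatorname{cl}S^0_A(\psi))\cap(\operatorname{cl}S_{-K}(\psi))=\emptyset$.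
   Context: $Y^*$ is the topological dual of $Y$, $\mathbb R_+=[0,\infty)$, $\mathbb P=(0,\infty)$. A set $K\subseteq Y$ is a cone if $0\in K=\mathbb R_+\cdot K$ (not necessarily convex); it is nontrivial if $\{0\}\ne K\ne Y$. $\mathbb B_\psi:=\{y\in Y\mid\psi(y)\le1\}$. For a cone $C$: $B_C(\psi):=\{x\in C\mid\psi(x)=1\}$, $S_C(\psi):=\operatorname{conv}(B_C(\psi))$, $S^0_C(\psi):=\operatorname{conv}(\{0\}\cup B_C(\psi))$. $B_C(\psi)$ is called a normlike-base for the nontrivial cone $C$ if $\psi(x)>0$ for all $x\in C\setminus\{0\}$. The seminorm $\psi$ is not assumed continuous. *)

(* Defs.v *)
From mathcomp Require Export all_boot all_order all_algebra.
From mathcomp Require Export all_classical all_reals.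
From mathcomp Require Export topology normedtype convex.

Set Implicit Arguments.
Unset Strict Implicit.
Unset Printing Implicit Defensive.

Export Order.TTheory GRing.Theory Num.Theory.
Export numFieldNormedType.Exports.

Local Open Scope classical_set_scope.
Local Open Scope ring_scope.

Section algebraic.
Context {R : realType} {Y : lmodType R}.
Implicit Types (A K C : set Y) (psi : Y -> R).

(* Cones need not be convex. *)
Definition is_cone K :=
  K 0 /\ K = [set t *: x | t in [set t : R | 0 <= t] & x in K].

Definition nontrivial_cone K := [/\ is_cone K, [set 0] <> K & K <> setT].

Definition opp_set A : set Y := -%R @` A.

Definition conv A : set Y := smallest (@convex_set R Y) A.

(* Neither definiteness nor continuity is required, and nonnegativity
   follows from the two axioms. *)
Definition is_seminorm psi :=
  (forall x y, psi (x + y) <= psi x + psi y) /\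
  (forall (t : R) x, psi (t *: x) = `|t| * psi x).

Definition psi_ball psi : set Y := [set y | psi y <= 1].

Definition base C psi : set Y := [set x | C x /\ psi x = 1].

Definition base_hull C psi : set Y := conv (base C psi).

Definition base_hull0 C psi : set Y := conv ([set 0] `|` base C psi).

(* The property that [base C psi] is a normlike-base for [C]. *)
Definition normlike_base C psi := forall x, (C `\ 0) x -> 0 < psi x.

End algebraic.

(* Main.v *)
Require Import Defs.
From mathcomp Require Import interval_inference derive lra.
Local Open Scope classical_set_scope.
Local Open Scope ring_scope.

(** In case (b), every point of [A] lying in the closed [psi]-unit ball
    satisfies [f < alpha]: otherwise it would belong to
    [A `&` closure (conv (opp_set K))] and hence be [0]. So [f < alpha] on the
    base of [A] and at [0], thus on their convex hull, and each of (i)-(iv)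
    makes this strict inequality survive the closure. *)

Section hulls.
Context {R : realType}.

Lemma conv_subset (Y : lmodType R) (A B : set Y) :
  A `<=` B -> conv A `<=` conv B.
Proof.
move=> AB x xA C [cC BC]; apply: xA; split => //; exact: subset_trans BC.
Qed.

Lemma convex_scalar_lt (Y : lmodType R) (f : {scalar Y}) (a : R) :
  convex_set [set x : Y | f x < a].
Proof.
apply/convex_setW => x y /[!inE] /= fx fy t t0 t1.
rewrite inE; change (f (t%:num *: x + (1 - t%:num) *: y) < a).
rewrite linearD !linearZ /=.
by nra.
Qed.

Lemma convex_scalar_le (Y : lmodType R) (f : {scalar Y}) (a : R) :
  convex_set [set x : Y | f x <= a].
Proof.
move=> x y t /[!inE] /= fx fy.
change (f (t%:num *: x + (1 - t%:num) *: y) <= a).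
rewrite linearD !linearZ /=.
have t0 : 0 <= t%:num by []; have t1 : t%:num <= 1 by [].
by nra.
Qed.

(** Compactness turns the strict bound into a uniform one: [f] attains its maximum over [C] at some
    [c], and the half-space [f x <= f c] is closed and convex, so it absorbs the closed convex hull,
    while [f c < a]. The hull itself need not be compact. *)
Lemma closure_conv_compact_lt (Y : topologicalLmodType R) (f : {scalar Y})
    (a : R) (C : set Y) :
  continuous f -> compact C -> C !=set0 -> C `<=` [set x | f x < a] ->
  closure (conv C) `<=` [set x | f x < a].
Proof.
move=> cf cC C0 Ca.
have [|c Cc fc] := compact_EVT_max (f := f) C0 cC.
  exact: continuous_subspaceT.
have cl : closed [set x | f x <= f c].
  by apply: (preimage_closed _ (@closed_le _ _)) => x _; exact: cf.
move=> x xC /=; apply: le_lt_trans (Ca _ (set_mem Cc)).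
move: x xC; rewrite closureE; apply: smallest_sub => //.
apply: smallest_sub; first exact: convex_scalar_le.
by move=> y Cy; apply: fc; rewrite inE.
Qed.

End hulls.

Theorem proposition19 (R : realType) (Y : topologicalLmodType R)
    (psi : Y -> R) (K A : set Y)
    (psi_seminorm : is_seminorm psi)
    (K_cone : nontrivial_cone K) (A_cone : nontrivial_cone A)
    (K_base : normlike_base K psi) (A_base : normlike_base A psi)
    (AK0 : A `&` closure (conv (opp_set K)) = [set 0])
    (SK0 : ~ closure (base_hull (opp_set K) psi) 0)
    (Hab :
      (closed A /\ convex_set A)
      \/
      ((exists (f : {scalar Y}) (alpha : R),
          [/\ continuous f, 0 < alpha &
              closure (base_hull (opp_set K) psi) =
              [set x | closure (psi_ball psi) x /\ alpha <= f x]]) /\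
       [\/ compact (base A psi),
           closed (base_hull0 A psi),
           closed A /\ compact (closure (base A psi)) |
           closed A /\ closed (conv (closure (base A psi) `|` [set 0]))])) :
  closure (base_hull0 A psi) `&` closure (base_hull (opp_set K) psi) = set0.
Proof.
have A0 : A 0 by case: A_cone => -[].
(* The hull is built from points of [opp_set K], so by [AK0] a common point with [A] could only be
   [0], which [SK0] excludes. *)
have AS x : A x -> ~ closure (base_hull (opp_set K) psi) x.
  move=> Ax xS; suff x0 : x = 0 by apply: SK0; rewrite -x0.
  have : (A `&` closure (conv (opp_set K))) x.
    by split => //; apply: closureS xS; apply: conv_subset => y [].
  by rewrite AK0.
rewrite -subset0 => x [xA xS].
case: Hab => [[clA cvA]|[[f [a [cf a0 SE]]] Hcl]].
  (* Case (a): [A] is a closed convex set containing [0] and its base, hence all of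
     [closure (base_hull0 A psi)]. *)
  apply: (AS x) => //; move: x xA {xS}.
  rewrite closureE; apply: smallest_sub => //.
  by apply: smallest_sub => // y [->|[]].
have f0 : f 0 < a by rewrite linear0.
have fA y : A y -> closure (psi_ball psi) y -> f y < a.
  by move=> Ay yB; rewrite ltNge; apply/negP => fy; apply: (AS y) => //;
    rewrite SE.
have BA : base A psi `<=` A by move=> y [].
have BB : base A psi `<=` psi_ball psi by move=> y [_ y1]; rewrite /psi_ball /= y1.
have fB : base A psi `<=` [set y | f y < a].
  by move=> y By; apply: fA; [exact: BA|apply: subset_closure; exact: BB].
(* As [psi] may be discontinuous, a limit of base points can leave the base and even the [psi]-unit
   ball. It stays in [A] and in the closure of the ball, which is all that [fA] asks. *)
have fclB : closed A -> closure (base A psi) `<=` [set y | f y < a].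
  move=> clA y yB; apply: fA; last exact: closureS yB.
  by rewrite (closure_id A).1//; exact: closureS yB.
have compact_case (C : set Y) : compact C -> base A psi `<=` C ->
    C `<=` [set y | f y < a] -> f x < a.
  move=> cC BC fC.
  (* Adjoining [0] matches the generators of [base_hull0] and makes the compact set nonempty; the
     bound at [0] is [f0]. *)
  apply: (@closure_conv_compact_lt _ _ f a ([set 0] `|` C)) => //.
  - by apply: compactU => //; exact: compact_set1.
  - by exists 0; left.
  - by move=> y [->|/fC].
  - by apply: closureS xA; apply: conv_subset; exact: setUS.
suff : f x < a by move: xS; rewrite SE => -[_ ax]; rewrite ltNge ax.
case: Hcl => [cB|clS|[clA cB]|[clA clS]].
- exact: compact_case cB _ fB.
(* Here [x] lies in the hull itself, with no limit left to take, so convexity of the strict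
   half-space suffices. *)
- have : base_hull0 A psi x by rewrite (closure_id (base_hull0 A psi)).1.
  apply: (@smallest_sub _ _ _ [set y | f y < a]);
    first exact: convex_scalar_lt.
  by move=> y [->|/fB].
- by apply: compact_case cB _ (fclB clA); exact: subset_closure.
(* This larger hull is closed, so it contains [closure (base_hull0 A psi)]; its generators satisfy
   the strict bound by [fclB] and [f0]. *)
- have : conv (closure (base A psi) `|` [set 0]) x.
    move/closure_id: clS => ->; apply: closureS xA.
    by apply: conv_subset; rewrite setUC; apply: setSU; exact: subset_closure.
  apply: (@smallest_sub _ _ _ [set y | f y < a]);
    first exact: convex_scalar_lt.
  by move=> y [/(fclB clA)|->].
Qed.
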